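(* Let $\ell\in\mathbb{N}$ and let $v(x)$ be an odd real polynomial whose leading coefficient is irrational. If for every $\epsilon>0$ the set $\mathcal R(v,\epsilon)=\{n\in\mathbb{N}:\|v(n)\|<\epsilon\}$ is a $\Delta_\ell^*$ set, then $\deg(v)\le 2\ell-1$.
   Context: $\mathbb{N}=\{1,2,\dots\}$; $\|x\|$ is the distance from $x$ to the nearest integer. A real polynomial is odd if it is of the form $\sum_j a_jx^{2j-1}$. Define $\partial:\bigcup_{\ell\ge1}\mathbb{Z}^{2^\ell}\to\mathbb{Z}$ recursively by $\partial(m_1,m_2)=m_2-m_1$ and $\partial(m_1,\dots,m_{2^\ell})=\partial(m_{2^{\ell-1}+1},\dots,m_{2^\ell})-\partial(m_1,\dots,m_{2^{\ell-1}})$ for $\ell>1$. A set $E\subseteq\mathbb{N}$ is $\Delta_\ell^*$ if for every increasing sequence $(n_k)_{k\in\mathbb{N}}$ in $\mathbb{N}$ there exist $k_1<\dots<k_{2^\ell}$ with $\partial(n_{k_1},\dots,n_{k_{2^\ell}})\in E$. *)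

(* Defs.v *)
From HB Require Import structures.
From mathcomp Require Import all_boot all_order all_algebra.
From mathcomp Require Import all_classical all_reals.

Set Implicit Arguments.
Unset Strict Implicit.
Unset Printing Implicit Defensive.

Import Order.TTheory GRing.Theory Num.Theory.
Local Open Scope classical_set_scope.
Local Open Scope ring_scope.

Definition dist_int (R : realType) (x : R) : R :=
  inf [set `|x - m%:~R| | m in [set: int]].

Definition odd_poly_form (R : realType) (v : {poly R}) : Prop :=
  exists (r : nat) (a : nat -> R),
    v = \sum_(1 <= j < r.+1) a j *: 'X^(2 * j - 1).

(* Intended for [l >= 1] and [size s = 2 ^ l] only; the value at [l = 0] is
   junk. *)
Fixpoint iter_diff_seq (l : nat) (s : seq int) : int :=
  match l with
  | 0 => 0
  | 1 => s`_1 - s`_0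
  | l'.+1 => iter_diff_seq l' (drop (2 ^ l') s)
             - iter_diff_seq l' (take (2 ^ l') s)
  end.

Definition iter_diff (l : nat) (m : (2 ^ l).-tuple int) : int :=
  iter_diff_seq l m.

(* The positive integers are the positive elements of [nat].  Sequences in
   them, and hence the indices k_1 < ... < k_(2^l), are numbered from 0. *)
Definition Delta_star (l : nat) (E : set nat) : Prop :=
  E `<=` [set e | (0 < e)%N] /\
  forall n : nat -> nat,
    (forall k, (0 < n k)%N) -> {homo n : i j / (i < j)%N} ->
    exists k : (2 ^ l).-tuple nat, sorted ltn k /\
      exists2 e : nat, E e & iter_diff [tuple of [seq (n i)%:Z | i <- k]] = e%:Z.

Definition return_set (R : realType) (v : {poly R}) (eps : R) : set nat :=
  [set n | (0 < n)%N /\ dist_int v.[n%:R] < eps].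

(* Main.v *)
(* Suppose [d = deg v >= 2 l + 1].  By Ramsey's theorem Delta_l^* sets are closed under intersection, so
   [v (2 ^ i x)], for [i <= d], all return along a common difference; an integer combination of
   these polynomials is [a x ^ d] with [a] irrational, so it suffices to treat this monomial.

   The points [(a n, ..., a n ^ d)] are dense in the torus.  Hence, with [p = d - 2 l] and any [Q],
   there is a sequence of multiples of [Q] along which, modulo 1, [a n ^ 2] tends to [a], [a n ^ p]
   to [1 / Q], and the other powers to [0], each term being much finer than the previous ones.
   Adding a signed term [s n] to a partial sum [x] of earlier ones then gives
   [a (x + s n) ^ j = a x ^ j + C(j, 2) a x ^ (j - 2) + [j = p] s / Q], approximately, for odd [j].
   Solving the recursion, [a (iterated difference) ^ d] is close to [K / Q], where [K] is a positive
   integer times the [X ^ l]-coefficient of [sum_t s_t (1 + X) ^ (2 ^ l - t)].  The signs of the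
   iterated difference are those of the Thue-Morse sequence, for which this polynomial is the product
   of the [1 - (1 + X) ^ (2 ^ k)], [k < l], so [K <> 0].  For [Q = 2 K] the limit is [1 / 2]. *)

Require Import Defs.
From HB Require Import structures.
From mathcomp Require Import all_boot all_order all_algebra.
From mathcomp Require Import all_classical all_reals.
From mathcomp Require Import ring lra zify.

Set Implicit Arguments.
Unset Strict Implicit.
Unset Printing Implicit Defensive.

Import Order.TTheory GRing.Theory Num.Theory.
Local Open Scope classical_set_scope.
Local Open Scope ring_scope.

(** * Approximation modulo one *)

Section ApproximationModOne.
Context {R : realType}.
Implicit Types (x y z e d a : R) (m n k : nat).

Definition mod1_near e x y := exists z : int, `|x - y - z%:~R| <= e.

Lemma mod1_near_refl e x : 0 <= e -> mod1_near e x x.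
Proof. by move=> e0; exists 0; rewrite subrr subr0 normr0. Qed.

Lemma mod1_near_le e e' x y : e <= e' -> mod1_near e x y -> mod1_near e' x y.
Proof. by move=> le [z hz]; exists z; apply: le_trans le. Qed.

Lemma mod1_near_ge0 e x y : mod1_near e x y -> 0 <= e.
Proof. by case=> z; apply: le_trans. Qed.

Lemma mod1_nearC e x y : mod1_near e x y -> mod1_near e y x.
Proof.
case=> z hz; exists (- z); rewrite -normrN; apply: le_trans hz.
by rewrite le_eqVlt; apply/orP; left; apply/eqP; congr `|_|; rewrite rmorphN; ring.
Qed.

Lemma mod1_nearD e1 e2 x1 y1 x2 y2 : mod1_near e1 x1 y1 ->
  mod1_near e2 x2 y2 -> mod1_near (e1 + e2) (x1 + x2) (y1 + y2).
Proof.
case=> z1 h1 [z2 h2]; exists (z1 + z2).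
have -> : x1 + x2 - (y1 + y2) - (z1 + z2)%:~R
  = (x1 - y1 - z1%:~R) + (x2 - y2 - z2%:~R) by rewrite rmorphD; ring.
by apply: le_trans (ler_normD _ _) _; apply: lerD.
Qed.

Lemma mod1_near_trans y e1 e2 x z : mod1_near e1 x y ->
  mod1_near e2 y z -> mod1_near (e1 + e2) x z.
Proof.
move=> h1 h2; have [w hw] := mod1_nearD h1 h2; exists w.
by apply: le_trans hw; rewrite (_ : x + y - _ - _ = x - z - w%:~R) //; ring.
Qed.

Lemma mod1_near_norm e x y : `|x - y| <= e -> mod1_near e x y.
Proof. by move=> h; exists 0; rewrite subr0. Qed.

Lemma mod1_near_int e x y (z : int) :
  mod1_near e x y -> mod1_near e (x + z%:~R) y.
Proof.
case=> w hw; exists (w + z); apply: le_trans hw.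
by rewrite rmorphD (_ : x + z%:~R - y - _ = x - y - w%:~R) //=; ring.
Qed.

Lemma mod1_nearZ (c : int) e x y : mod1_near e x y ->
  mod1_near (`|c%:~R| * e) (c%:~R * x) (c%:~R * y).
Proof.
case=> z hz; exists (c * z).
rewrite (_ : _ - _ - _ = c%:~R * (x - y - z%:~R)); last by rewrite rmorphM; ring.
by rewrite normrM ler_wpM2l.
Qed.

Lemma mod1_nearN e x y : mod1_near e x y -> mod1_near e (- x) (- y).
Proof. by move=> /(mod1_nearZ (-1)); rewrite mulrN1z normrN1 mul1r !mulN1r. Qed.

Lemma mod1_nearMn k e x y : mod1_near e x y ->
  mod1_near (k%:R * e) (k%:R * x) (k%:R * y).
Proof. by move=> /(mod1_nearZ k); rewrite -pmulrn normr_nat. Qed.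

Lemma mod1_near_sum (e x y : nat -> R) n :
  (forall i, (i < n)%N -> mod1_near (e i) (x i) (y i)) ->
  mod1_near (\sum_(i < n) e i) (\sum_(i < n) x i) (\sum_(i < n) y i).
Proof.
elim: n => [|n IH] h; first by rewrite !big_ord0; apply: mod1_near_refl.
by rewrite !big_ord_recr /=; apply: mod1_nearD; [apply: IH => i hi|]; apply: h; lia.
Qed.

Lemma mod1_near_half e : mod1_near e (2^-1) 0 -> 2^-1 <= e.
Proof.
case=> z; apply: le_trans; rewrite subr0.
have [|z1] := lerP z 0.
  rewrite -(@ler_int R) => z0; rewrite ler_normr; apply/orP; left; lra.
have : 1 <= z by lia.
rewrite -(@ler_int R) => z0; rewrite ler_normr; apply/orP; right; lra.
Qed.

(** Pigeonhole: the [n + 1] fractional parts of [i * x], for [i <= n], fall into [n] cells of length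
    [1 / n]. *)
Lemma dirichlet x n : (0 < n)%N ->
  exists2 k, (0 < k <= n)%N & mod1_near n%:R^-1 (k%:R * x) 0.
Proof.
move=> n0; have nR : 0 < n%:R :> R by rewrite ltr0n.
pose f i := n%:R * (i%:R * x - (Num.floor (i%:R * x))%:~R).
have f0 i : 0 <= f i by rewrite mulr_ge0 ?ler0n // subr_ge0 floor_le.
have fn i : f i < n%:R.
  rewrite -[ltRHS]mulr1 ltr_pM2l // ltrBlDl.
  by have := floorD1_gt (i%:R * x); rewrite rmorphD /= .
pose g (i : 'I_n.+1) := inord (Num.trunc (f i)) : 'I_n.-1.+1.
have gE i : g i = Num.trunc (f i) :> nat.
  rewrite inordK // prednK //; have /andP [h _] := truncn_itv (f0 i).
  by rewrite -(ltr_nat R); apply: le_lt_trans h (fn _).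
have : ~~ injectiveb g.
  by apply/negP => /injectiveP /leq_card; rewrite !card_ord prednK // ltnn.
move=> /injectivePn [i [j ij gij]].
wlog lt_ij : i j ij gij / (i < j)%N.
  move=> H; have [|h|/val_inj e] := ltngtP i j; first exact: H.
    by apply: (H j i) => //; rewrite eq_sym.
  by rewrite e eqxx in ij.
exists (j - i)%N; first by have := ltn_ord j; lia.
exists (Num.floor (j%:R * x) - Num.floor (i%:R * x)).
have /andP [h1 h2] := truncn_itv (f0 i); have /andP [h3 h4] := truncn_itv (f0 j).
rewrite -gE gij gE in h1 h2.
rewrite -(ler_pM2l nR) divff ?gt_eqF // -[n%:R in X in X <= _]ger0_norm ?ler0n //.
rewrite -normrM natrB ?(ltnW lt_ij) // rmorphB /=.
rewrite (_ : n%:R * _ = f j - f i); last by rewrite /f; ring.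
rewrite -natr1 in h2 h4.
by rewrite ler_norml; apply/andP; split; lra.
Qed.

Lemma irrational_int_mul (z : int) a :
  z != 0 -> irrational a -> irrational (z%:~R * a).
Proof.
move=> z0 ia [q _ hq]; apply: ia; exists (q / z%:~R) => //.
rewrite rmorphM fmorphV /= ratr_int hq mulrAC divff ?mul1r //.
by rewrite intr_eq0.
Qed.

Lemma irrational_not_int a (z : int) : irrational a -> a != z%:~R.
Proof. by move=> ia; apply/eqP => h; apply: ia; exists z%:~R => //; rewrite ratr_int. Qed.

(** By Dirichlet some multiple of [a] differs from an integer by a nonzero [eta] with [|eta| <= e];
    its multiples walk round the circle in steps of that length. *)
Lemma kronecker a x e m : irrational a -> 0 < e ->
  exists2 n, (m <= n)%N & mod1_near e (a * n%:R) x.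
Proof.
move=> ia e0; pose K := (Num.bound e^-1).+1.
have hK : K%:R^-1 <= e.
  have ie : 0 <= e^-1 by rewrite invr_ge0 ltW.
  have := archi_boundP ie => h; rewrite -[leRHS]invrK lef_pV2 ?posrE ?invr_gt0 ?ltr0n //.
  by apply: ltW; apply: lt_le_trans h _; rewrite ler_nat.
have [k /andP [k0 _] [z hz]] := dirichlet a (ltn0Sn (Num.bound e^-1)).
rewrite subr0 in hz; set eta := k%:R * a - z%:~R in hz.
have eta0 : eta != 0.
  rewrite subr_eq0; apply: irrational_not_int.
  by apply: (@irrational_int_mul k) => //; rewrite eqz_nat -lt0n.
have eta_pos : 0 < `|eta| by rewrite normr_gt0.
(* [x + w] has the sign of [eta] and is so large that [t >= m]. *)
pose J := (Num.bound (`|x| + m%:R)).+1.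
have hJ : `|x| + m%:R < J%:R.
  have h : 0 <= `|x| + m%:R by rewrite addr_ge0 ?ler0n.
  by apply: lt_trans (archi_boundP h) _; rewrite ltr_nat.
pose w : int := if 0 < eta then J%:Z else - J%:Z.
pose t := (x + w%:~R) / eta.
have ht : m%:R <= t.
  have eta1 : `|eta| <= 1.
    by apply: le_trans hz _; rewrite invf_le1 ?ltr0n // ler1n.
  have xl := ler_norm x; have xl' := ler_norm (- x); rewrite normrN in xl'.
  rewrite /t /w; case: (ltrP 0 eta) => h.
    rewrite ler_pdivlMr //; rewrite gtr0_norm // in eta1.
    have : m%:R * eta <= m%:R by rewrite -[leRHS]mulr1 ler_wpM2l ?ler0n.
    rewrite -pmulrn; lra.
  have h' : eta < 0 by rewrite lt_neqAle eta0.
  rewrite ler_ndivlMr //; rewrite ltr0_norm // in eta1.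
  have : m%:R * (- eta) <= m%:R by rewrite -[leRHS]mulr1 ler_wpM2l ?ler0n.
  rewrite rmorphN /= -pmulrn; lra.
have t0 : 0 <= t by apply: le_trans ht; rewrite ler0n.
(* [t] steps would land exactly on [x + w]; rounding [t] costs at most one step. *)
pose i := Num.trunc t; have /andP [i1 i2] := truncn_itv t0.
exists (i * k)%N.
  have mi : (m <= i)%N by rewrite -ltnS -(ltr_nat R); apply: le_lt_trans ht i2.
  by apply: leq_trans mi _; rewrite -[leqLHS]muln1 leq_mul2l k0 orbT.
exists (i%:Z * z + w).
rewrite rmorphD rmorphM /= natrM -pmulrn.
rewrite (_ : _ - _ - _ = (i%:R - t) * eta); last first.
  by rewrite mulrBl /t divfK // /eta; ring.
rewrite normrM; apply: le_trans (le_trans hz hK).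
rewrite -[leRHS]mul1r ler_wpM2r ?normr_ge0 //.
by rewrite -natr1 in i2; rewrite ler_norml; apply/andP; split; lra.
Qed.

End ApproximationModOne.

(** * Density of the powers of [n] times an irrational *)

Section PolynomialDensity.
Context {R : realType}.
Implicit Types (a x y z e d r s th : R) (i j k m n p : nat).

Lemma sum_binomialS n : \sum_(i < n) 'C(n, i.+1)%:R <= 2 ^+ n :> R.
Proof.
have := exprDn (1 : R) 1 n; rewrite -[1 + 1]/(2 : R) => ->.
rewrite big_ord_recl /= -[X in X <= _]add0r; apply: lerD.
  by rewrite mulrn_wge0 // mulr_ge0 ?expr1n.
by apply: ler_sum => i _; rewrite !expr1n mul1r.
Qed.

(** In the binomial expansion the coefficients of the [a * y ^ i] are integers, so closeness modulo
    one survives multiplication by them; their absolute values add up to at most [(2 * B) ^ j]. *)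
Lemma mod1_near_exprD a (T : nat -> R) (x y : int) B d j :
  1 <= B -> `|x%:~R| <= B -> 0 <= d ->
  (forall i, (0 < i <= j)%N -> mod1_near d (a * y%:~R ^+ i) (T i)) ->
  mod1_near ((2 * B) ^+ j * d) (a * (x + y)%:~R ^+ j)
    (a * x%:~R ^+ j
     + \sum_(i < j) 'C(j, i.+1)%:R * x%:~R ^+ (j - i.+1) * T i.+1).
Proof.
move=> B1 xB d0 h.
have -> : a * (x + y)%:~R ^+ j = a * x%:~R ^+ j
    + \sum_(i < j) 'C(j, i.+1)%:R * x%:~R ^+ (j - i.+1) * (a * y%:~R ^+ i.+1).
  rewrite rmorphD exprDn big_ord_recl /= bin0 subn0 expr0 mulr1 mulrDr mulr_sumr.
  congr (_ + _); apply: eq_bigr => i _.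
  by rewrite /bump /= add1n -[in LHS]mulr_natl; ring.
rewrite -[X in mod1_near X]add0r; apply: mod1_nearD; first exact: mod1_near_refl.
apply: (@mod1_near_le _ (\sum_(i < j) 'C(j, i.+1)%:R * B ^+ j * d)).
  rewrite -!mulr_suml exprMn; do 2 (apply: ler_wpM2r => //).
    by rewrite exprn_ge0 // (le_trans ler01).
  exact: sum_binomialS.
apply: (@mod1_near_sum _ (fun i => 'C(j, i.+1)%:R * B ^+ j * d)
   (fun i => 'C(j, i.+1)%:R * x%:~R ^+ (j - i.+1) * (a * y%:~R ^+ i.+1))
   (fun i => 'C(j, i.+1)%:R * x%:~R ^+ (j - i.+1) * T i.+1)) => i ij.
have /(mod1_nearZ ('C(j, i.+1)%:Z * x ^+ (j - i.+1))) := h i.+1 ij.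
rewrite rmorphM rmorphXn /= -pmulrn; apply: mod1_near_le.
apply: ler_wpM2r => //; rewrite normrM normr_nat; apply: ler_wpM2l => //.
rewrite normrX; apply: (@le_trans _ _ (B ^+ (j - i.+1))).
  by apply: lerXn2r => //; rewrite nnegrE // (le_trans ler01).
by apply: ler_weXn2l => //; lia.
Qed.

Definition powers_dense a p := forall (t : nat -> R) e m, 0 < e ->
  exists2 n, (m <= n)%N & forall i, (0 < i <= p)%N ->
    mod1_near e (a * n%:R ^+ i) (t i).

Definition small_powers a p d n :=
  forall i, (0 < i < p)%N -> mod1_near d (a * n%:R ^+ i) 0.

(** For [r = 0] these are the limit points modulo one of [a * n ^ p] along sequences whose lower
    powers tend to [0]; the slack [r] replaces compactness by a test of finitely many arcs. *)
Definition cluster a p r th := forall d m, 0 < d ->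
  exists n, [/\ (m <= n)%N, small_powers a p d n &
    mod1_near (r + d) (a * n%:R ^+ p) th].

Definition growth n p : R := (2 * n.+1%:R) ^+ p.

Lemma growth_ge1 n p : 1 <= growth n p.
Proof. by apply: exprn_ege1; rewrite -natrM ler1n. Qed.

Lemma growth_gt0 n p : 0 < growth n p.
Proof. exact: lt_le_trans ltr01 (growth_ge1 n p). Qed.

Lemma growth_le n p q : (p <= q)%N -> growth n p <= growth n q.
Proof. by move=> pq; apply: ler_weXn2l => //; rewrite -natrM ler1n. Qed.

Lemma mod1_near_exprD_nat a (T : nat -> R) n1 n2 d j : 0 <= d ->
  (forall i, (0 < i <= j)%N -> mod1_near d (a * n2%:R ^+ i) (T i)) ->
  mod1_near (growth n1 j * d) (a * (n1 + n2)%:R ^+ j)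
    (a * n1%:R ^+ j
     + \sum_(i < j) 'C(j, i.+1)%:R * n1%:R ^+ (j - i.+1) * T i.+1).
Proof.
move=> d0 h; apply: (@mod1_near_exprD a T n1 n2 n1.+1%:R) => //.
  by rewrite ler1n.
by rewrite -pmulrn normr_nat ler_nat.
Qed.

Lemma mod1_near_exprD_low a n1 n2 d j : 0 <= d ->
  (forall i, (0 < i <= j)%N -> mod1_near d (a * n2%:R ^+ i) 0) ->
  mod1_near (growth n1 j * d) (a * (n1 + n2)%:R ^+ j) (a * n1%:R ^+ j).
Proof.
move=> d0 /(mod1_near_exprD_nat (T := fun=> 0) n1 d0).
by rewrite big1 ?addr0 // => i _; rewrite mulr0.
Qed.

Lemma mod1_near_exprD_top a n1 n2 d p : 0 <= d -> small_powers a p.+1 d n2 ->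
  mod1_near (growth n1 p.+1 * d) (a * (n1 + n2)%:R ^+ p.+1)
    (a * n1%:R ^+ p.+1 + a * n2%:R ^+ p.+1).
Proof.
move=> d0 h.
pose T i := if i == p.+1 then a * n2%:R ^+ p.+1 else 0.
have := @mod1_near_exprD_nat a T n1 n2 d p.+1 d0.
rewrite big_ord_recr big1 /=; last first.
  by move=> i _; rewrite /T eqSS ltn_eqF // mulr0.
rewrite /T eqxx binn subnn expr0 !mul1r add0r; apply=> i ip.
case: eqP => [->|ne]; first exact: mod1_near_refl.
by apply: h; lia.
Qed.

(** The one cross term that survives carries [n2 ^ p.+1], with coefficient [p.+2 * n1]: a small
    [eta] is magnified by [n1]. *)
Lemma mod1_near_exprD_shift a n1 n2 d p eta : 0 <= d ->
  small_powers a p.+1 d n2 -> mod1_near d (a * n2%:R ^+ p.+1) eta ->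
  mod1_near (growth n1 p.+2 * d) (a * (n1 + n2)%:R ^+ p.+2)
    (a * n1%:R ^+ p.+2 + a * n2%:R ^+ p.+2 + p.+2%:R * n1%:R * eta).
Proof.
move=> d0 h heta.
pose T i := if i == p.+2 then a * n2%:R ^+ p.+2 else if i == p.+1 then eta else 0.
have := @mod1_near_exprD_nat a T n1 n2 d p.+2 d0.
rewrite !big_ord_recr big1 /=; last first.
  by move=> i _; rewrite /T !eqSS !ltn_eqF ?mulr0 // ltnW // ltnS.
rewrite /T !eqSS !eqxx ltn_eqF // binn subnn expr0 !mul1r add0r binSn.
rewrite subSnn expr1 addrA [X in _ -> mod1_near _ _ X]addrAC; apply=> i ip.
case: eqP => [->|ne]; first exact: mod1_near_refl.
by case: eqP => [->//|ne']; apply: h; lia.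
Qed.

Lemma cluster_le a p r r' th : r <= r' -> cluster a p r th -> cluster a p r' th.
Proof.
move=> rr h d m d0; have [n [h1 h2 h3]] := h d m d0; exists n; split => //.
by apply: mod1_near_le h3; lra.
Qed.

Lemma cluster_near a p r r' th th' : mod1_near r' th th' ->
  cluster a p r th -> cluster a p (r + r') th'.
Proof.
move=> rr h d m d0; have [n [h1 h2 h3]] := h d m d0; exists n; split => //.
by apply: mod1_near_le (mod1_near_trans h3 rr); lra.
Qed.

(** [n2] is chosen after [n1], at a tolerance that absorbs the growth factor of [n1]; the cross
    terms are then negligible. *)
Lemma clusterD a p r1 r2 th1 th2 : cluster a p.+1 r1 th1 ->
  cluster a p.+1 r2 th2 -> cluster a p.+1 (r1 + r2) (th1 + th2).
Proof.
move=> h1 h2 d m d0; have d3 : 0 < d / 3 by lra.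
have [n1 [mn1 s1 c1]] := h1 (d / 3) m d3.
have g0 := growth_gt0 n1 p.+1; have g1 := growth_ge1 n1 p.+1.
have [|n2 [mn2 s2 c2]] := h2 (d / 3 / growth n1 p.+1) m; first exact: divr_gt0.
set d' := d / 3 / _ in s2 c2.
have d'0 : 0 < d' by exact: divr_gt0.
have gd' : growth n1 p.+1 * d' = d / 3 by rewrite mulrC divfK ?gt_eqF.
have d'd : d' <= d / 3 by rewrite -gd' -[leLHS]mul1r ler_wpM2r // ltW.
exists (n1 + n2)%N; split; first by lia.
  move=> i /andP [i0 ip]; have := s1 i; rewrite i0 ip => /(_ isT) si.
  apply: mod1_near_le (mod1_near_trans (mod1_near_exprD_low n1 (ltW d'0) _) si).
    have : growth n1 i * d' <= d / 3.
      by rewrite -gd' ler_wpM2r ?growth_le ?(ltW d'0) // ltnW.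
    lra.
  by move=> k ki; apply: s2; lia.
have := mod1_near_exprD_top n1 (ltW d'0) s2.
move=> /mod1_near_trans /(_ (mod1_nearD c1 c2)); apply: mod1_near_le.
rewrite gd'; lra.
Qed.

Lemma clusterMn a p r th k : cluster a p.+1 r th ->
  cluster a p.+1 (k.+1%:R * r) (k.+1%:R * th).
Proof.
move=> h; elim: k => [|k IH]; first by rewrite !mul1r.
by have := clusterD IH h; rewrite -[k.+2%:R]natr1 !mulrDl !mul1r.
Qed.

(** A positive multiple serves as the negative: if [j * th] is near an integer, then
    [(2 * j - 1) * th] is near [- th]. Unlike [j - 1], this factor is positive also for [j = 1]. *)
Lemma clusterN a p r th k : (0 < k)%N -> 0 <= r -> cluster a p.+1 r th ->
  cluster a p.+1 (2 * k%:R * r + 2 / k%:R) (- th).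
Proof.
move=> k0 r0 h; have [j /andP [j0 jk] hj] := dirichlet th k0.
have hn : mod1_near (2 / k%:R) ((2 * j - 1)%N%:R * th) (- th).
  have := mod1_nearD (mod1_nearMn 2 hj) (mod1_near_refl (- th) (lexx 0)).
  rewrite mulr0 add0r addr0 natrB; last by lia.
  by rewrite natrM mulrBl mul1r -mulrA.
have e : (2 * j - 1 = (2 * j - 2).+1)%N by lia.
have := clusterMn (2 * j - 2) h; rewrite -e => /(cluster_near hn).
apply: cluster_le; rewrite lerD2r; apply: ler_wpM2r => //.
by rewrite -natrM ler_nat; lia.
Qed.

(* An arc of length [<= r] that is not a cluster is avoided for some [d] and [m]; take the best
   [d] and [m] over the finitely many such arcs of a partition of the circle. *)
Lemma cluster_exists a p r : 0 < r -> exists d m, 0 < d /\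
  forall n, (m <= n)%N -> small_powers a p d n ->
    exists2 th, cluster a p r th & mod1_near r (a * n%:R ^+ p) th.
Proof.
move=> r0; pose L := (Num.bound r^-1).+1.
have L0 : 0 < L%:R :> R by rewrite ltr0n.
have hL : L%:R^-1 <= r.
  have ie : 0 <= r^-1 by rewrite invr_ge0 ltW.
  have := archi_boundP ie => h; rewrite -[leRHS]invrK lef_pV2 ?posrE ?invr_gt0 ?ltr0n //.
  by apply: ltW; apply: lt_le_trans h _; rewrite ler_nat.
have cell x : exists2 c, (c < L)%N & mod1_near r x (c%:R / L%:R).
  pose y := x - (Num.floor x)%:~R.
  have y0 : 0 <= y by rewrite subr_ge0 floor_le.
  have y1 : y < 1 by have := floorD1_gt x; rewrite rmorphD /= /y; lra.
  have Ly : 0 <= L%:R * y by rewrite mulr_ge0 ?ler0n.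
  have /andP [] := truncn_itv Ly; move: (Num.trunc _) => c t1 t2; exists c.
    rewrite -(ltr_nat R); apply: le_lt_trans t1 _.
    by rewrite -[ltRHS]mulr1 ltr_pM2l.
  exists (Num.floor x); apply: le_trans hL.
  rewrite -(ler_pM2l L0) divff ?gt_eqF // -[X in X * `|_|]gtr0_norm //.
  rewrite -normrM (_ : L%:R * _ = L%:R * y - c%:R); last first.
    by rewrite !mulrBr [L%:R * (_ / _)]mulrC divfK ?gt_eqF // addrAC.
  by rewrite -natr1 in t2; rewrite ler_norml; apply/andP; split; lra.
have [d [m [d0 h]]] : exists d m, 0 < d /\ forall n, (m <= n)%N ->
    small_powers a p d n -> forall c, (c < L)%N ->
    mod1_near r (a * n%:R ^+ p) (c%:R / L%:R) -> cluster a p r (c%:R / L%:R).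
  (* The denominator is generalized, so that the induction runs over the number of arcs while the
     arcs stay fixed. *)
  elim: L {L0 hL cell} (L%:R : R) => [|L IH] q; first by exists 1, 0.
  have [d [m [d0 h]]] := IH q.
  have [hc|] := pselect (cluster a p r (L%:R / q)).
    exists d, m; split => // n mn sn c; rewrite ltnS leq_eqVlt.
    by move=> /orP [/eqP -> //|]; apply: h sn _ => //; exact: mn.
  move=> /existsNP [d' /existsNP [m' /not_implyP [d'0 hn]]].
  exists (Num.min d d'), (maxn m m'); split; first by rewrite lt_min d0.
  move=> n; rewrite geq_max => /andP [mn m'n] sn c; rewrite ltnS leq_eqVlt.
  have sd : small_powers a p d n.
    by move=> i /sn; apply: mod1_near_le; rewrite ge_min lexx.
  have sd' : small_powers a p d' n.
    by move=> i /sn; apply: mod1_near_le; rewrite ge_min lexx orbT.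
  move=> /orP [/eqP -> hr|]; last by apply: h mn sd _.
  by exfalso; apply: hn; exists n; split => //; apply: mod1_near_le hr; lra.
exists d, m; split => // n mn sn; have [c cL hc] := cell (a * n%:R ^+ p).
by exists (c%:R / L%:R) => //; apply: h mn sn _ _ _.
Qed.

(* Once [n1] is fixed, [a n2 ^ p.+1] can be steered to [s / (p.+2 n1)], and then [a (n1 + n2) ^ p.+2]
   is close to [a n1 ^ p.+2 + a n2 ^ p.+2 + s]; clusters form a group, so [s] is one. *)
Lemma powers_dense_cluster a p s r : powers_dense a p.+1 -> 0 < r ->
  cluster a p.+2 r s.
Proof.
(* Negating two clusters will cost [4 * K * r0' + 4 / K]; with [K >= 16 / r] and
   [r0' = r / (16 * K)] each summand is at most [r / 4]. *)
move=> D r0; pose K := (Num.bound (16 / r)).+1.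
have K0 : 0 < K%:R :> R by rewrite ltr0n.
have hK : 4 / K%:R <= r / 4.
  have h : 0 <= 16 / r by rewrite divr_ge0 // ltW.
  have {}h : 16 / r <= K%:R.
    by apply: ltW; apply: lt_le_trans (archi_boundP h) _; rewrite ler_nat.
  rewrite ler_pdivrMr //; rewrite ler_pdivrMr // in h; lra.
pose r0' := r / 16 / K%:R.
have r0'0 : 0 < r0' by rewrite !divr_gt0.
have Kr : K%:R * r0' = r / 16 by rewrite mulrC divfK ?gt_eqF.
have r0'r : r0' <= r / 16.
  by rewrite -Kr -[leLHS]mul1r ler_wpM2r ?ler1n // ltW.
have [d [m [d0 hc]]] := cluster_exists a p.+2 r0'0.
(* [n1] is taken so large that [eta], of size at most [|s| / n1], stays below [d / 4]: then [n2] has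
   small powers below [p.+2] even though its power [p.+1] is steered to [eta]. *)
pose m1 := maxn m (Num.bound (4 * `|s| / d)).+1.
have d3 : 0 < d / 4 by lra.
have [n1 mn1 hn1] := D (fun=> 0) (d / 4) m1 d3.
have sn1 : small_powers a p.+2 (d / 4) n1 by move=> i hi; apply: hn1.
have mn : (m <= n1)%N by apply: leq_trans mn1; rewrite leq_maxl.
have n10 : 0 < n1%:R :> R by rewrite ltr0n; apply: leq_trans mn1; rewrite leq_max ltn0Sn orbT.
have n1s : `|s| <= d / 4 * n1%:R.
  have h : 0 <= 4 * `|s| / d by rewrite divr_ge0 ?mulr_ge0 // ltW.
  have {}h : 4 * `|s| / d <= n1%:R.
    apply: ltW; apply: lt_le_trans (archi_boundP h) _; rewrite ler_nat.
    by apply: leq_trans mn1; rewrite leq_max leqnSn orbT.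
  rewrite ler_pdivrMr // in h; lra.
pose eta := s / (p.+2%:R * n1%:R).
have eta_s : p.+2%:R * n1%:R * eta = s.
  by rewrite mulrC divfK // gt_eqF // mulr_gt0.
have eta_d : `|eta| <= d / 4.
  rewrite normrM normfV [X in _ / X]gtr0_norm ?mulr_gt0 // ler_pdivrMr ?mulr_gt0 //.
  apply: le_trans n1s _; apply: ler_wpM2l; first exact: ltW.
  by rewrite -[leLHS]mul1r ler_wpM2r ?ler1n // ltW.
pose t i := if i == p.+1 then eta else 0.
pose d' := Num.min (d / 4) (r / 8) / growth n1 p.+2.
have g0 := growth_gt0 n1 p.+2; have g1 := growth_ge1 n1 p.+2.
have m0 : 0 < Num.min (d / 4) (r / 8) by rewrite lt_min; apply/andP; split; lra.
have d'0 : 0 < d' by exact: divr_gt0.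
have gd' : growth n1 p.+2 * d' = Num.min (d / 4) (r / 8) by rewrite mulrC divfK ?gt_eqF.
have gd : growth n1 p.+2 * d' <= d / 4 by rewrite gd' ge_min lexx.
have gr : growth n1 p.+2 * d' <= r / 8 by rewrite gd' ge_min lexx orbT.
have d'd : d' <= d / 4 by apply: le_trans gd; rewrite -[leLHS]mul1r ler_wpM2r // ltW.
have [n2 mn2 hn2] := D t d' m d'0.
have s2 : small_powers a p.+1 d' n2.
  by move=> i hi; have := hn2 i; rewrite /t ltn_eqF; [apply|]; clear -hi; lia.
have e2 : mod1_near d' (a * n2%:R ^+ p.+1) eta.
  by have := hn2 p.+1; rewrite /t eqxx ltnSn; apply.
have sn2 : small_powers a p.+2 d n2.
  move=> i /andP [i0]; rewrite ltnS leq_eqVlt => /orP [/eqP ->|ip].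
    have e3 : mod1_near (d / 4) eta 0 by apply: mod1_near_norm; rewrite subr0.
    by apply: mod1_near_le (mod1_near_trans e2 e3); lra.
  by apply: mod1_near_le (s2 i _); [lra|rewrite i0].
have sn3 : small_powers a p.+2 d (n1 + n2).
  move=> i /andP [i0]; rewrite ltnS leq_eqVlt => /orP [/eqP ->|ip].
    have e3 : mod1_near (d / 4) eta 0 by apply: mod1_near_norm; rewrite subr0.
    have e1 : mod1_near (d / 4) (a * n1%:R ^+ p.+1) 0 by apply: sn1; rewrite ltnSn.
    have := mod1_near_exprD_top n1 (ltW d'0) s2.
    have e4 := mod1_nearD e1 (mod1_near_trans e2 e3); rewrite add0r in e4.
    move=> /mod1_near_trans /(_ e4); apply: mod1_near_le.
    have : growth n1 p.+1 * d' <= d / 4.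
      by apply: le_trans gd; rewrite ler_wpM2r ?growth_le // ltW.
    lra.
  have e1 : mod1_near (d / 4) (a * n1%:R ^+ i) 0 by apply: sn1; clear -i0 ip; lia.
  apply: mod1_near_le (mod1_near_trans (mod1_near_exprD_low n1 (ltW d'0) _) e1).
    have : growth n1 i * d' <= d / 4.
      by apply: le_trans gd; rewrite ler_wpM2r ?growth_le ?(ltW d'0) //; clear -ip; lia.
    lra.
  by move=> k ki; apply: s2; clear -ki ip; lia.
have sn1' : small_powers a p.+2 d n1.
  by move=> i /sn1; apply: mod1_near_le; lra.
have [th1 c1 h1] := hc n1 mn sn1'; have [th2 c2 h2] := hc n2 mn2 sn2.
have [|th3 c3 h3] := hc (n1 + n2)%N _ sn3; first by clear -mn; lia.
have hs := mod1_near_exprD_shift n1 (ltW d'0) s2 e2; rewrite eta_s in hs.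
have hth := mod1_nearD (mod1_nearD (mod1_near_trans (mod1_nearC h3) hs)
  (mod1_nearN (mod1_nearC h1))) (mod1_nearN (mod1_nearC h2)).
rewrite (_ : _ + _ - _ - _ = s) in hth; last by ring.
have K0' : (0 < K)%N by [].
have := clusterD (clusterD c3 (clusterN K0' (ltW r0'0) c1)) (clusterN K0' (ltW r0'0) c2).
move=> /(cluster_near hth); apply: cluster_le.
have -> : 2 * K%:R * r0' = r / 8 by rewrite -mulrA Kr; lra.
have : 2 / K%:R <= r / 8 by lra.
by move: gr r0'r r0; clear; move: (_ * d') (2 / _) r0' => x y z; lra.
Qed.

(** Induction from Kronecker's theorem: [n1] meets the targets of the lower powers, and [n2], with
    negligible lower powers, supplies what the top power still lacks, every real number being a
    cluster. *)
Lemma powers_dense_irrational a p : irrational a -> powers_dense a p.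
Proof.
move=> ia; elim: p => [|[|p] IH] t e m e0.
- by exists m => // i; lia.
- have [n mn hn] := kronecker (t 1) m ia e0; exists n => // i hi.
  by have -> : i = 1%N by lia.
have e2 : 0 < e / 2 by lra.
have [n1 mn1 h1] := IH t (e / 2) m e2.
have g0 := growth_gt0 n1 p.+2; have g1 := growth_ge1 n1 p.+2.
pose d := e / 4 / growth n1 p.+2.
have e4 : 0 < e / 4 by lra.
have d0 : 0 < d by exact: divr_gt0.
have gd : growth n1 p.+2 * d = e / 4 by rewrite mulrC divfK ?gt_eqF.
have dd : d <= e / 4 by rewrite -gd -[leLHS]mul1r ler_wpM2r // ltW.
have [n2 [mn2 s2 c2]] :=
  powers_dense_cluster (t p.+2 - a * n1%:R ^+ p.+2) IH e4 m d0.
exists (n1 + n2)%N; first by lia.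
move=> i /andP [i0]; rewrite leq_eqVlt => /orP [/eqP ->|ip].
  have h := mod1_nearD (mod1_near_refl (a * n1%:R ^+ p.+2) (lexx 0)) c2.
  rewrite [_ + (_ - _)]addrC subrK in h.
  apply: mod1_near_le (mod1_near_trans (mod1_near_exprD_top n1 (ltW d0) s2) h).
  by rewrite gd; lra.
have e1 := h1 i _; rewrite i0 in e1.
apply: mod1_near_le (mod1_near_trans (mod1_near_exprD_low n1 (ltW d0) _) (e1 ip)).
  have : growth n1 i * d <= e / 4.
    by rewrite -gd ler_wpM2r ?growth_le ?(ltW d0) // ltnW.
  lra.
by move=> k ki; apply: s2; lia.
Qed.

End PolynomialDensity.

(** * Iterated differences and their signs *)

(** The usual Thue-Morse signs up to a global sign: the negated copy comes first, as the first half
    is subtracted in [iter_diff_seq]. *)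
Fixpoint thue_morse (l : nat) : seq int :=
  if l is l'.+1 then map -%R (thue_morse l') ++ thue_morse l' else [:: 1].

Lemma size_thue_morse l : size (thue_morse l) = (2 ^ l)%N.
Proof. by elim: l => //= l IH; rewrite size_cat size_map IH expnS; lia. Qed.

Lemma thue_morse_unit l s : s \in thue_morse l -> `|s| = 1.
Proof.
elim: l s => [|l IH] s /=; first by rewrite inE => /eqP ->.
by rewrite mem_cat => /orP [/mapP [t /IH ht ->]|/IH //]; rewrite normrN.
Qed.

Definition signed_sum (s t : seq int) : int := \sum_(x <- zip s t) x.1 * x.2.

Lemma signed_sumN s t : signed_sum (map -%R s) t = - signed_sum s t.
Proof.
rewrite /signed_sum; elim: s t => [|x s IH] [|y t] //=; rewrite ?big_nil ?oppr0 //.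
by rewrite !big_cons IH /= mulNr opprD.
Qed.

Lemma signed_sumZ (c : int) s t :
  signed_sum s (map ( *%R c) t) = c * signed_sum s t.
Proof.
rewrite /signed_sum; elim: s t => [|x s IH] [|y t] //=; rewrite ?big_nil ?mulr0 //.
by rewrite !big_cons IH /= mulrDr mulrCA.
Qed.

Lemma iter_diff_seqE l (s : seq int) : (0 < l)%N -> size s = (2 ^ l)%N ->
  iter_diff_seq l s = signed_sum (thue_morse l) s.
Proof.
case: l => // l _; elim: l s => [|l IH] s hs.
  case: s hs => [|x [|y [|z s]]] // _.
  by rewrite /signed_sum /= !big_cons big_nil /=; ring.
have h2 : (2 ^ l.+2 = 2 ^ l.+1 + 2 ^ l.+1)%N by rewrite expnS; lia.
rewrite -[iter_diff_seq _ _]/(iter_diff_seq l.+1 (drop (2 ^ l.+1) s)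
  - iter_diff_seq l.+1 (take (2 ^ l.+1) s)).
rewrite !IH ?size_drop ?size_take ?hs ?h2 ?addnK //; last first.
  by case: ltnP => //; lia.
rewrite -[in RHS](cat_take_drop (2 ^ l.+1) s).
rewrite -[thue_morse l.+2]/(map -%R (thue_morse l.+1) ++ thue_morse l.+1).
rewrite [RHS]/signed_sum zip_cat ?big_cat; last first.
  by rewrite size_map size_thue_morse size_take hs h2; case: ltnP => //; lia.
by rewrite -![\sum_(x <- _) _]/(signed_sum _ _) /= signed_sumN addrC.
Qed.

(* The sum of the [e_t (1 + X) ^ (m - t)] for [e = e_1, ..., e_m]. *)
Definition sign_poly (e : seq int) : {poly int} :=
  foldl (fun P a => (1 + 'X) * P + a%:P) 0 e.

Lemma sign_poly_rcons e a : sign_poly (rcons e a) = (1 + 'X) * sign_poly e + a%:P.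
Proof. by rewrite /sign_poly foldl_rcons. Qed.

Lemma sign_polyN e : sign_poly (map -%R e) = - sign_poly e.
Proof.
elim/last_ind: e => [|e a IH]; first by rewrite /sign_poly /= oppr0.
by rewrite map_rcons !sign_poly_rcons IH polyCN mulrN opprD.
Qed.

Lemma sign_poly_cat e f :
  sign_poly (e ++ f) = (1 + 'X) ^+ size f * sign_poly e + sign_poly f.
Proof.
elim/last_ind: f => [|f a IH]; first by rewrite cats0 mul1r addr0.
rewrite -rcons_cat !sign_poly_rcons IH size_rcons exprS; ring.
Qed.

(** Each doubling multiplies the polynomial by [1 - (1 + X) ^ (2 ^ l)], which is [X] times a
    cofactor with value [- 2 ^ l] at [0]. *)
Lemma sign_poly_thue_morse_coef l : (sign_poly (thue_morse l))`_l != 0.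
Proof.
suff [H -> H0] : exists2 H, sign_poly (thue_morse l) = 'X^l * H & H.[0] != 0.
  by rewrite coefXnM ltnn subnn -horner_coef0.
elim: l => [|l [H IH H0]].
  exists 1; last by rewrite hornerE.
  by rewrite /sign_poly /= mulr0 add0r expr0 mul1r.
exists (- (\sum_(i < 2 ^ l) (1 + 'X) ^+ i) * H).
  rewrite /= sign_poly_cat sign_polyN size_thue_morse IH.
  have /eqP := subrX1 (1 + 'X : {poly int}) (2 ^ l).
  rewrite [1 + 'X - 1]addrC addKr subr_eq => /eqP ->.
  by rewrite exprS; ring.
rewrite hornerM hornerN mulf_neq0 // oppr_eq0 horner_sum.
under eq_bigr do rewrite horner_exp !hornerE expr1n.
by rewrite sumr_const card_ord pnatr_eq0 -lt0n expn_gt0.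
Qed.

(** * Lacunary sequences with prescribed powers modulo one *)

Section LacunarySequence.
Context {R : realType}.
Implicit Types (a x y z e : R) (i j k m n p d q N : nat).

(** Steer the powers of [n] to [T i / q ^ i] and multiply [n] by [q]. *)
Lemma exists_multiple_steering a d q (T : nat -> R) N e : irrational a ->
  (0 < q)%N -> 0 < e -> exists n, [/\ (N < n)%N, (q %| n)%N &
    forall i, (0 < i <= d)%N -> mod1_near e (a * n%:R ^+ i) (T i)].
Proof.
move=> ia q0 e0; have q1 : 1 <= q%:R :> R by rewrite ler1n.
have qd i : 0 < q%:R ^+ i :> R by rewrite exprn_gt0 // ltr0n.
have [|n Nn hn] := powers_dense_irrational d ia (fun i => T i / q%:R ^+ i)
  (e := e / q%:R ^+ d) N.+1; first exact: divr_gt0.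
exists (q * n)%N; split; [|exact: dvdn_mulr|].
  by apply: leq_trans Nn _; rewrite -[leqLHS]mul1n leq_mul2r q0 orbT.
move=> i hi; have := mod1_nearMn (q ^ i) (hn i hi).
rewrite !natrX [_ * (T i / _)]mulrC divfK ?gt_eqF // natrM exprMn [_ * (a * _)]mulrCA.
apply: mod1_near_le; rewrite mulrA ler_pdivrMr // mulrC ler_pM2l //.
by apply: ler_weXn2l => //; case/andP: hi.
Qed.

(** [u k.+1] is chosen at tolerance [delta (u k)], which is at most [delta (u j)] for [j <= k] as
    [delta] is antitone. The term [u 0] is only a seed; steered multiples of [q] start at index
    1. *)
Lemma exists_steering_sequence a d q (T delta : nat -> R) : irrational a ->
  (0 < q)%N -> (forall n, 0 < delta n) ->
  {homo delta : m n / (m <= n)%N >-> n <= m} ->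
  exists u : nat -> nat, [/\ u 0%N = 1%N, {homo u : i j / (i < j)%N},
    forall k, (q %| u k.+1)%N &
    forall j k, (j < k)%N -> forall i, (0 < i <= d)%N ->
      mod1_near (delta (u j)) (a * (u k)%:R ^+ i) (T i)].
Proof.
move=> ia q0 delta0 deltaM.
have /choice [f hf] N := exists_multiple_steering d T N ia q0 (delta0 N).
pose u k := iter k f 1%N.
have uS k : (u k < u k.+1)%N by have [] := hf (u k).
have um : {homo u : i j / (i < j)%N} by apply: homo_ltn => //; exact: ltn_trans.
exists u; split => // [k|j [|k] // jk i hi]; first by have [] := hf (u k).
have [_ _ /(_ i hi)] := hf (u k); apply: mod1_near_le; apply: deltaM.
by move: jk; rewrite ltnS leq_eqVlt => /orP [/eqP ->//|/um/ltnW].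
Qed.

End LacunarySequence.

(** * Ramsey's theorem and Delta_l^* sets *)

Section InfiniteRamsey.
Implicit Types (i j k m n : nat) (s t : seq nat).

Definition increasing (f : nat -> nat) := {homo f : i j / (i < j)%N}.

Lemma increasingS f : (forall k, f k < f k.+1)%N -> increasing f.
Proof. by move=> h; apply: homo_ltn => //; exact: ltn_trans. Qed.

Lemma increasing_sorted f s : increasing f -> sorted ltn s -> sorted ltn (map f s).
Proof. by move=> hf; apply: homo_sorted. Qed.

Lemma constant_subsequence (b : nat -> bool) :
  exists f c, increasing f /\ forall k, b (f k) = c.
Proof.
have [h|] := pselect (forall N, exists n, (N <= n)%N && b n).
  have /choice [g hg] := h.
  exists (fun k => iter k (fun i => g i.+1) (g 0%N)), true; split.
    by apply: increasingS => k /=; have /andP [] := hg (iter k (fun i => g i.+1) (g 0%N)).+1.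
  by case=> [|k] /=; [have /andP [] := hg 0%N|
    have /andP [] := hg (iter k (fun i => g i.+1) (g 0%N)).+1].
move=> /existsNP [N hN]; exists (addn N), false; split.
  by move=> i j; rewrite ltn_add2l.
move=> k; apply/negbTE/negP => hb; apply: hN; exists (N + k)%N.
by rewrite leq_addr.
Qed.

(** Induction on [m]: choose points [x n] one by one, each time thinning the remaining sequence so
    that the colour of an [m.+1]-set depends only on its least point; then pass to points of one
    colour. *)
Lemma infinite_ramsey m (P : seq nat -> Prop) : exists f (c : bool),
  increasing f /\ forall s, sorted ltn s -> size s = m -> `[< P (map f s) >] = c.
Proof.
elim: m P => [|m IH] P.
  by exists id, `[< P [::] >]; split => // -[].
have /choice [F hF] (psi : nat -> nat) : exists fc : (nat -> nat) * bool,
    increasing fc.1 /\ forall s, sorted ltn s -> size s = m ->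
    `[< P (psi 0%N :: map (fun i => psi (fc.1 i).+1) s) >] = fc.2.
  have [f [c [hf h]]] := IH (fun s => P (psi 0%N :: map (fun i => psi i.+1) s)).
  by exists (f, c); split => // s ss sm; rewrite -(h s ss sm) -map_comp.
pose next psi i : nat := psi ((F psi).1 i).+1.
pose Psi n := iter n next id.
have PsiM n : increasing (Psi n).
  elim: n => [//|n IHn] i j ij; apply: IHn; rewrite ltnS.
  by have [h _] := hF (Psi n); apply: h.
pose x n := Psi n 0%N.
have xM : increasing x by apply: increasingS => n; apply: PsiM.
(* The condition [n <= k] stands under the quantifier so that choice yields a total function
   [tau]. *)
have xPsi n k : exists j, (n <= k)%N -> x k = Psi n j.
  suff H i : (n <= k)%N -> exists j, Psi k i = Psi n j.
    by have [/(H 0%N) [j hj]|] := leqP n k; [exists j|exists 0%N].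
  elim: k i => [|k IHk] i; first by rewrite leqn0 => /eqP ->; exists i.
  rewrite leq_eqVlt => /orP [/eqP ->|]; first by exists i.
  by rewrite ltnS => /IHk - /(_ ((F (Psi k)).1 i).+1).
have key n s : sorted ltn s -> size s = m -> all (leq n.+1) s ->
    `[< P (x n :: map x s) >] = (F (Psi n)).2.
  move=> ss sm sn; have /choice [tau htau] := xPsi n.+1.
  have [_ h] := hF (Psi n); rewrite -(h (map tau s)).
  - rewrite -map_comp; congr `[< P (_ :: _) >]; apply/eq_in_map => k ks.
    by apply: htau; exact: (allP sn).
  - apply: (homo_sorted_in _ sn ss) => i j hi hj ij.
    have := xM _ _ ij; rewrite (htau i hi) (htau j hj) => {}h.
    have [//|/(PsiM n.+1) e|e] := ltngtP (tau i) (tau j).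
      by have := ltn_trans h e; rewrite ltnn.
    by rewrite e ltnn in h.
  - by rewrite size_map.
have [f [c [fM hc]]] := constant_subsequence (fun n => (F (Psi n)).2).
exists (x \o f), c; split; first by move=> i j /fM /xM.
move=> [|i s] //= ss [sm]; rewrite map_comp key ?size_map //.
  by apply: increasing_sorted fM _; apply: path_sorted ss.
rewrite all_map; apply/allP => j js /=; apply: fM.
by have := order_path_min ltn_trans ss => /allP; apply.
Qed.

End InfiniteRamsey.

Section DeltaStar.
Context (l : nat).

(** On a subsequence homogeneous for having the difference in [E], the colour is true because [E]
    meets it; the tuple supplied by [F] on the same subsequence then has its difference in [E]
    too. *)
Lemma Delta_star_setI (E F : set nat) :
  Delta_star l E -> Delta_star l F -> Delta_star l (E `&` F).
Proof.
move=> [E0 hE] [F0 hF]; split; first by move=> e [/E0].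
move=> n n0 nM.
pose P s := exists2 e : nat, E e & iter_diff_seq l [seq (n i)%:Z | i <- s] = e%:Z.
have [f [c [fM hf]]] := infinite_ramsey (2 ^ l) P.
have nf0 k : (0 < (n \o f) k)%N by apply: n0.
have nfM : {homo n \o f : i j / (i < j)%N} by move=> i j /fM /nM.
have [k [ks [e Ee he]]] := hE _ nf0 nfM.
have cT : c = true.
  rewrite -(hf k ks (size_tuple k)); apply/asboolP; exists e => //.
  by rewrite -he /iter_diff /= -map_comp.
have [k' [ks' [e' Fe he']]] := hF _ nf0 nfM.
exists (map_tuple f k'); split; first exact: increasing_sorted.
have := hf k' ks' (size_tuple k'); rewrite cT => /asboolP [e'' Ee'' he''].
have eq_e : e'%:Z = e''%:Z by rewrite -he' -he'' /iter_diff /= -map_comp.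
by exists e'; [split => //; case: eq_e => ->|rewrite -he' /iter_diff /= -map_comp].
Qed.

Lemma Delta_star_scale (c : nat) (E : set nat) : (0 < l)%N -> (0 < c)%N ->
  Delta_star l E -> Delta_star l [set e | (0 < e)%N /\ E (c * e)%N].
Proof.
move=> l0 c0 [E0 hE]; split; first by move=> e [].
move=> n n0 nM; have [||k [ks [e Ee he]]] := hE (fun i => c * n i)%N.
- by move=> k; rewrite muln_gt0 c0 n0.
- by move=> i j /nM h; rewrite ltn_pmul2l.
exists k; split => //; move: he; rewrite /iter_diff /=.
have -> : [seq (c * n i)%N%:Z | i <- k] = map ( *%R c%:Z) [seq (n i)%:Z | i <- k].
  by rewrite -map_comp; apply: eq_map => i /=; rewrite PoszM.
rewrite !iter_diff_seqE ?size_map ?size_tuple // signed_sumZ.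
case: (signed_sum _ _) => w he; last by exfalso; nia.
have we : (c * w)%N = e by apply/eqP; rewrite -eqz_nat PoszM he.
exists w => //; split; last by rewrite we.
by have := E0 _ Ee; rewrite /= -we muln_gt0 => /andP [].
Qed.

Lemma Delta_starS (E F : set nat) : E `<=` F -> F `<=` [set e | (0 < e)%N] ->
  Delta_star l E -> Delta_star l F.
Proof.
move=> EF F0 [_ hE]; split => // n n0 nM; have [k [ks [e /EF Fe he]]] := hE n n0 nM.
by exists k; split => //; exists e.
Qed.

End DeltaStar.

(** * Steering sums *)

Section Steering.
Context {R : realType}.
Implicit Types (a B e delta eta : R) (i j k n p d : nat) (Q x s : int).

(* The value [1 / Q] is killed by any further factor, since all terms are multiples of [Q]. *)
Definition steering_target a p Q i : R :=
  if i == 2%N then a else if i == p then Q%:~R^-1 else 0.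

Lemma sum_pick (F : nat -> R) c j t : (0 < c)%N ->
  (forall i, (j < i)%N -> F i = 0) ->
  \sum_(i < j) F i.+1 * (if i.+1 == c then t else 0) = F c * t.
Proof.
case: c => // c _ h; have [cj|jc] := ltnP c j.
  rewrite (bigD1 (Ordinal cj)) //= eqxx big1 ?addr0 // => i ic.
  by rewrite eqSS -[c]/(val (Ordinal cj)) val_eqE (negbTE ic) mulr0.
rewrite h ?mul0r // big1 // => i _; rewrite eqSS ltn_eqF ?mulr0 //.
exact: leq_trans (ltn_ord i) jc.
Qed.

Lemma unit_int_sqr s : `|s| = 1 -> s ^+ 2 = 1.
Proof. by move=> h; rewrite -real_normK ?num_real // h. Qed.

Lemma unit_int_odd s i : `|s| = 1 -> odd i -> s ^+ i = s.
Proof.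
move=> h oi; rewrite -(odd_double_half i) oi -mul2n exprD exprM unit_int_sqr //.
by rewrite expr1n mulr1.
Qed.

(** Only the powers [2] and [p] of [s * n] contribute. The first gives ['C(j, 2) * a * x ^ (j - 2)],
    as [s ^ 2 = 1]. The second gives ['C(j, p) * x ^ (j - p) * s / Q], as [p] is odd; this is [0]
    for [j < p], and an integer for [j > p] because [Q] divides [x]. *)
Lemma steering_step a p Q x s n B delta j : odd p -> Q != 0 ->
  `|s| = 1 -> (Q %| x)%Z -> 1 <= B -> `|x%:~R| <= B -> 0 <= delta ->
  (forall i, (0 < i <= j)%N ->
     mod1_near delta (a * n%:R ^+ i) (steering_target a p Q i)) ->
  mod1_near ((2 * B) ^+ j * delta) (a * (x + s * n%:Z)%:~R ^+ j)
    (a * x%:~R ^+ j + 'C(j, 2)%:R * (a * x%:~R ^+ (j - 2))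
     + (if j == p then s%:~R / Q%:~R else 0)).
Proof.
move=> op Q0 s1 Qx B1 xB d0 h.
have p2 : p != 2%N by apply: contraTneq op => ->.
pose F i : R := 'C(j, i)%:R * x%:~R ^+ (j - i).
have hs i : s%:~R ^+ i * steering_target a p Q i =
    (if i == 2%N then a else 0) + (if i == p then s%:~R / Q%:~R else 0).
  rewrite /steering_target -rmorphXn; case: eqP => [->|_].
    by rewrite unit_int_sqr // mul1r eq_sym (negbTE p2) addr0.
  by case: eqP => [->|_]; rewrite add0r ?mulr0 ?unit_int_odd.
have := @mod1_near_exprD R a (fun i => s%:~R ^+ i * steering_target a p Q i)
  x (s * n%:Z) B delta j B1 xB d0.
have -> : \sum_(i < j) 'C(j, i.+1)%:R * x%:~R ^+ (j - i.+1) *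
    (s%:~R ^+ i.+1 * steering_target a p Q i.+1)
    = F 2%N * a + F p * (s%:~R / Q%:~R).
  have F0 i : (j < i)%N -> F i = 0 by move=> ji; rewrite /F bin_small // mul0r.
  rewrite -(@sum_pick F 2 j a) // -(@sum_pick F p j) ?odd_gt0 //.
  by rewrite -big_split /=; apply: eq_bigr => i _; rewrite hs mulrDr.
move=> H; have {H} : mod1_near ((2 * B) ^+ j * delta)
    (a * (x + s * n%:Z)%:~R ^+ j)
    (a * x%:~R ^+ j + (F 2%N * a + F p * (s%:~R / Q%:~R))).
  apply: H => i hi; have := mod1_nearZ (s ^+ i) (h i hi).
  rewrite rmorphXn /= normrX -intr_norm s1 expr1n mul1r.
  by rewrite rmorphM /= exprMn -pmulrn mulrCA.
have -> : F 2%N * a = 'C(j, 2)%:R * (a * x%:~R ^+ (j - 2)) by rewrite /F; ring.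
rewrite addrA; have [jp|pj|jp] := ltngtP j p.
- by rewrite /F (bin_small jp) !mul0r.
- have /dvdzP [w xw] := Qx.
  have -> : F p * (s%:~R / Q%:~R)
      = ('C(j, p)%:Z * x ^+ (j - p).-1 * w * s)%:~R.
    have Qn : Q%:~R != 0 :> R by rewrite intr_eq0.
    rewrite /F -[in LHS](prednK (_ : (0 < j - p)%N)) ?subn_gt0 // exprSr.
    by rewrite !rmorphM rmorphXn /= -pmulrn {2}xw rmorphM /=; field.
  move=> /mod1_nearC H; apply: mod1_nearC; rewrite addr0.
  by have := mod1_near_int (- ('C(j, p)%:Z * x ^+ (j - p).-1 * w * s)) H; rewrite rmorphN addrK.
by rewrite /F jp binn subnn expr0 !mul1r.
Qed.

(** Equals [(p + 2 * i)! / (p! * 2 ^ i)]; the factors accrue as the degree climbs from [p] in steps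
    of two. *)
Fixpoint steering_weight p i : nat :=
  if i is i'.+1 then ('C(p + 2 * i, 2) * steering_weight p i')%N else 1%N.

Lemma steering_weight_gt0 p i : (0 < steering_weight p i)%N.
Proof. by elim: i => //= i IH; rewrite muln_gt0 IH andbT bin_gt0; lia. Qed.

(** Multiply the value at degree [p + 2 * i] by [Q] and divide it by [steering_weight p i]. By
    [steering_step] a new term of sign [s] adds to each of these coefficients the preceding one, and
    [s] to the constant one: this is the recursion [(1 + X) * P + s] of [sign_poly]. Each step
    multiplies the error by at most [2 ^ d + 2]. *)
Lemma steering_sum a p d Q W eta (u : nat -> nat) : odd p -> Q != 0 -> 0 < eta ->
  u 0%N = 1%N -> {homo u : i j / (i < j)%N} -> (forall k, `|Q| %| u k.+1)%N ->
  (forall j k, (j < k)%N -> forall i, (0 < i <= d)%N ->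
    mod1_near (eta / (2 * (W * u j).+1%:R) ^+ d) (a * (u k)%:R ^+ i)
      (steering_target a p Q i)) ->
  forall es : seq (int * nat), (size es <= W)%N ->
  all (fun c => `|c.1| == 1) es -> path ltn 0%N (map snd es) ->
  let X := \sum_(c <- es) c.1 * (u c.2)%:Z in
  let E := eta * (2 ^+ d + 2) ^+ size es in
  [/\ (Q %| X)%Z, `|X| <= (size es * u (last 0%N (map snd es)))%N%:Z,
    forall j, odd j -> (j < p)%N -> (j <= d)%N -> mod1_near E (a * X%:~R ^+ j) 0 &
    forall i, (p + 2 * i <= d)%N -> mod1_near E (a * X%:~R ^+ (p + 2 * i))
      ((steering_weight p i)%:R * ((sign_poly (map fst es))`_i)%:~R / Q%:~R)].
Proof.
move=> op Q0 eta0 u0 uM uQ hu; elim/last_ind => [|es [s k] IH].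
  move=> _ _ _ /=; rewrite big_nil expr0 mulr1; split; rewrite ?dvdz0 //.
  - by move=> j oj _ _; rewrite expr0n eqn0Ngt odd_gt0 // mulr0; apply/mod1_near_refl/ltW.
  - move=> i _; rewrite expr0n addn_eq0 eqn0Ngt odd_gt0 // mulr0 coef0 mulr0 mul0r.
    exact/mod1_near_refl/ltW.
rewrite size_rcons all_rcons map_rcons rcons_path => sW.
move=> /andP [/eqP /= s1 es1] /andP [pes /= lt_k].
have [] := IH (ltnW sW) es1 pes; rewrite map_rcons last_rcons sign_poly_rcons.
rewrite -cats1 big_cat big_seq1 /=.
move: lt_k (\sum_(c <- es) _); set kappa := last _ _ => lt_k X QX Xle low top.
set E := eta * _ in low top.
have uuk := uM _ _ lt_k.
pose C : R := 2 ^+ d; have C1 : 1 <= C by rewrite exprn_ege1 // ler1n.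
have E0 : eta <= E.
  rewrite /E -[leLHS]mulr1 ler_wpM2l ?(ltW eta0) // exprn_ege1 //.
  by rewrite -/C; lra.
have E' : E + C * E + eta <= eta * (2 ^+ d + 2) ^+ (size es).+1.
  rewrite exprS [leRHS]mulrCA -/E mulrDl -/C; move: E0.
  by move: (C * E) (E) => x y; lra.
pose B : R := (W * u kappa).+1%:R.
have B1 : 1 <= B by rewrite ler1n.
have XB : `|X%:~R| <= B.
  rewrite -intr_norm; apply: (@le_trans _ _ (size es * u kappa)%N%:Z%:~R).
    by rewrite ler_int.
  by rewrite -pmulrn ler_nat ltnW // ltnS leq_mul2r (ltnW sW) orbT.
have B0 : 0 < (2 * B) ^+ d by rewrite exprn_gt0 //; lra.
have step j : (j <= d)%N -> mod1_near eta (a * (X + s * (u k)%:Z)%:~R ^+ j)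
    (a * X%:~R ^+ j + 'C(j, 2)%:R * (a * X%:~R ^+ (j - 2))
     + (if j == p then s%:~R / Q%:~R else 0)).
  move=> jd; apply: mod1_near_le
    (@steering_step a p Q X s (u k) B (eta / (2 * B) ^+ d) j op Q0 s1 QX B1 XB _ _).
  - rewrite mulrA ler_pdivrMr // mulrC ler_wpM2l ?(ltW eta0) // ler_weXn2l //; lra.
  - by rewrite divr_ge0 ?ltW.
  - by move=> i /andP [i0 ij]; apply: hu => //; rewrite i0 (leq_trans ij).
have binC j : (j <= d)%N -> 'C(j, 2)%:R <= C.
  move=> jd; rewrite /C -natrX ler_nat.
  apply: (@leq_trans (2 ^ j)); last by rewrite leq_exp2l.
  case: j {jd} => [|[|j]] //; rewrite -[X in (_ <= X ^ _)%N]/(1 + 1)%N Pascal.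
  rewrite (bigD1 (inord 2)) //= inordK ?ltnS //; rewrite !exp1n !muln1; exact: leq_addr.
(* For [j < 2] the truncated exponent [j - 2] is [0], and [a * X ^ 0] is not controlled; there the
   binomial factor vanishes instead. *)
have combine j v w : (j <= d)%N -> mod1_near E (a * X%:~R ^+ j) v ->
    ('C(j, 2) = 0%N \/ mod1_near E (a * X%:~R ^+ (j - 2)) w) ->
    mod1_near (eta * (2 ^+ d + 2) ^+ (size es).+1) (a * (X + s * (u k)%:Z)%:~R ^+ j)
      (v + 'C(j, 2)%:R * w + (if j == p then s%:~R / Q%:~R else 0)).
  move=> jd h1 h2; apply: mod1_near_le E' _.
  have h3 : mod1_near (C * E) ('C(j, 2)%:R * (a * X%:~R ^+ (j - 2))) ('C(j, 2)%:R * w).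
    case: h2 => [->|h2].
      by rewrite !mul0r; apply: mod1_near_refl; rewrite mulr_ge0 //; lra.
    by apply: mod1_near_le (mod1_nearMn 'C(j, 2) h2); rewrite ler_wpM2r ?binC //; lra.
  rewrite addrC; apply: mod1_near_trans (step j jd) _.
  rewrite -[E + C * E]addr0; apply: mod1_nearD; last exact: mod1_near_refl.
  exact: mod1_nearD.
split.
(* The path starts at [0], so [k] is positive and the seed [u 0] is never a term. *)
- apply: rpredD => //; apply: dvdz_mull; rewrite dvdzE absz_nat; case: k lt_k {uuk step combine} => // k _.
- apply: le_trans (ler_normD _ _) _; rewrite normrM s1 mul1r mulSn PoszD addrC.
  apply: lerD; first by [].
  by apply: le_trans Xle _; rewrite lez_nat leq_mul2l (ltnW uuk) orbT.
- move=> j oj jp jd; have := @combine j 0 0 jd (low j oj jp jd).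
  rewrite (ltn_eqF jp) mulr0 !addr0; apply.
  case: j oj jp jd => [|[|[|j]]] // oj jp jd; [by left|right].
  by rewrite subn2; apply: low; [move: oj; rewrite /= !negbK|clear -jp; lia|clear -jd; lia].
- case=> [|i] hd.
    rewrite muln0 addn0 in hd *.
    have htop := top 0%N; rewrite muln0 addn0 in htop.
    have := @combine p _ 0 hd (htop hd).
    rewrite eqxx mulr0 addr0 /= !mul1r mulrDl mul1r !coefD coefXM coefC /= addr0.
    rewrite [(_ + s)%:~R]rmorphD mulrDl; apply.
    case: p op low hd {IH htop top combine step hu} => [|[|[|p]]] // op low hd; [by left|right].
    by rewrite subn2; apply: low; [move: op; rewrite /= !negbK|clear; lia|clear -hd; lia].
  have hd' : (p + 2 * i <= d)%N by clear -hd; lia.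
  have pj : (p + 2 * i.+1 - 2 = p + 2 * i)%N by clear; lia.
  have ne : (p + 2 * i.+1 == p) = false by clear; apply/negbTE; lia.
  have topi := top i hd'; rewrite -pj in topi.
  have := combine _ _ _ hd (top i.+1 hd) (or_intror topi); rewrite ne addr0.
  rewrite [steering_weight p i.+1]/= natrM mulrDl mul1r !coefD coefXM coefC /= addr0.
  by rewrite [(_`_i.+1 + _)%:~R]rmorphD !mulrDr !mulrDl !mulrA.
Qed.

End Steering.

(** * The monomial case, and elimination of lower degrees by dyadic dilations *)

Section Monomial.
Context {R : realType}.
Implicit Types (a eps x : R) (v : {poly R}) (i j k l p e : nat).

Lemma signed_sum_map (s : seq int) (t : seq nat) (f : nat -> int) :
  signed_sum s (map f t) = \sum_(c <- zip s t) c.1 * f c.2.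
Proof.
rewrite /signed_sum; elim: s t => [|x s IH] [|y t] //=; rewrite ?big_nil //.
by rewrite !big_cons IH.
Qed.

Lemma monomial_not_Delta_star a l p : irrational a -> (0 < l)%N -> odd p ->
  ~ Delta_star l [set e | (0 < e)%N /\
      mod1_near 8^-1 (a * e%:R ^+ (p + 2 * l)) 0].
Proof.
move=> ia l0 op [_ hD]; pose d := (p + 2 * l)%N; pose W := (2 ^ l)%N.
pose K : int := (steering_weight p l)%:Z * (sign_poly (thue_morse l))`_l.
have K0 : K != 0.
  by rewrite mulf_neq0 ?sign_poly_thue_morse_coef // eqz_nat -lt0n steering_weight_gt0.
pose Q : int := 2 * K; have Q0 : Q != 0 by rewrite mulf_neq0.
pose C : R := 2 ^+ d + 2.
have C0 : 0 < C by rewrite addr_gt0 ?exprn_gt0.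
(* After [W] terms the error [eta * C ^ W] is [1 / 4], and [1 / 4 + 1 / 8] is less than the distance
   [1 / 2] from [1 / 2] to the integers. *)
pose eta := 4^-1 / C ^+ W.
have eta0 : 0 < eta by rewrite divr_gt0 ?invr_gt0 ?exprn_gt0.
pose delta N : R := eta / (2 * (W * N).+1%:R) ^+ d.
have den0 N : 0 < (2 * (W * N).+1%:R) ^+ d :> R by rewrite exprn_gt0 // mulr_gt0.
have delta0 N : 0 < delta N by rewrite divr_gt0.
have deltaM : {homo delta : m n / (m <= n)%N >-> n <= m}.
  move=> m n mn; rewrite ler_wpM2l ?(ltW eta0) // lef_pV2 ?posrE //.
  by rewrite lerXn2r ?nnegrE ?mulr_ge0 // ler_wpM2l // ler_nat ltnS leq_mul2l mn orbT.
have q0 : (0 < `|Q|)%N by rewrite absz_gt0.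
have [u [u0 uM uQ hu]] :=
  exists_steering_sequence d (steering_target a p Q) ia q0 delta0 deltaM.
have [||k [ks [e [_ he] hk]]] := hD (fun i => u i.+1).
- by move=> i; apply: leq_ltn_trans (uM 0%N i.+1 _); rewrite ?u0.
- by move=> i j ij; apply: uM.
pose es := zip (thue_morse l) (map succn k).
have sz : size (thue_morse l) = size (map succn k).
  by rewrite size_map size_tuple size_thue_morse.
have e1 : map fst es = thue_morse l by apply: unzip1_zip; rewrite sz.
have e2 : map snd es = map succn k by apply: unzip2_zip; rewrite sz.
have ses : size es = W by rewrite size_zip -sz minnn size_thue_morse.
have [|||_ _ _ /(_ l (leqnn _))] := steering_sum op Q0 eta0 u0 uM uQ hu (es := es).
- by rewrite ses.
- apply/allP => c ces; apply/eqP; apply: (@thue_morse_unit l).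
  by rewrite -e1; apply: map_f.
- rewrite e2 path_sortedE; last exact: ltn_trans.
  by rewrite all_map; apply/andP; split; [apply/allP|apply: increasing_sorted].
have -> : \sum_(c <- es) c.1 * (u c.2)%:Z = e%:Z.
  rewrite -hk /iter_diff iter_diff_seqE ?size_map ?size_tuple //=.
  rewrite -(signed_sum_map _ _ (fun i => (u i)%:Z)) -map_comp //.
rewrite ses e1 -/C divfK ?gt_eqF ?exprn_gt0 // => h.
have := mod1_near_half (mod1_near_trans _ he).
have hh : mod1_near 4^-1 (2^-1) (a * e%:R ^+ d).
  apply: mod1_nearC; move: h; rewrite -/d.
  suff -> : (steering_weight p l)%:R * ((sign_poly (thue_morse l))`_l)%:~R / Q%:~R
    = 2^-1 :> R by [].
  have Kn : K%:~R != 0 :> R by rewrite intr_eq0.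
  rewrite (_ : _%:R * _ = K%:~R); last by rewrite /K rmorphM /= -pmulrn.
  have -> : Q%:~R = 2 * K%:~R :> R by rewrite /Q rmorphM.
  by rewrite invfM mulrCA divff ?mulr1.
move=> /(_ _ hh); lra.
Qed.

(* [w (2 x) - 2 ^ j w x] kills the monomial of degree [j]. *)
Definition dyadic_elim v j x : R :=
  \sum_(i < size v) v`_i * (\prod_(k < j) (2 ^+ i - 2 ^+ k)) * x ^+ i.

Lemma dyadic_elimS v j x :
  dyadic_elim v j.+1 x = dyadic_elim v j (2 * x) - 2 ^+ j * dyadic_elim v j x.
Proof.
rewrite /dyadic_elim mulr_sumr -sumrB; apply: eq_bigr => i _.
by rewrite big_ord_recr /= exprMn; ring.
Qed.

(** Each degree [i < d] meets the zero factor with [k = i]. *)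
Lemma dyadic_elim_lead v x : v != 0 -> let d := (size v).-1 in
  dyadic_elim v d x
  = (\prod_(k < d) (2 ^+ d - 2 ^+ k : int))%:~R * lead_coef v * x ^+ d.
Proof.
move=> v0 /=; rewrite /dyadic_elim; have : (0 < size v)%N by rewrite size_poly_gt0.
rewrite lead_coefE; case: (size v) => // d _ /=; rewrite big_ord_recr big1 /=.
  rewrite add0r [v`_d * _]mulrC; congr (_ * _ * _).
  rewrite rmorph_prod /=; apply: eq_bigr => k _.
  by rewrite rmorphB !rmorphXn.
by move=> i _; rewrite (bigD1 i) //= subrr mul0r mulr0 mul0r.
Qed.

Lemma mod1_near_lead v eps e : v != 0 -> let d := (size v).-1 in
  (forall i, (i <= d)%N -> mod1_near eps v.[(2 ^ i * e)%N%:R] 0) ->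
  mod1_near ((2 ^+ d + 1) ^+ d * eps)
    ((\prod_(k < d) (2 ^+ d - 2 ^+ k : int))%:~R * lead_coef v * e%:R ^+ d) 0.
Proof.
move=> v0 d h; rewrite -dyadic_elim_lead // -/d.
(* An elimination compares two consecutive dilations, so after [j] of them the estimate is left for
   [i <= d - j]. The elimination of degree [j] multiplies the error by [2 ^ j + 1], at most
   [2 ^ d + 1]. *)
suff H j : (j <= d)%N -> forall i, (i + j <= d)%N ->
    mod1_near ((2 ^+ d + 1) ^+ j * eps) (dyadic_elim v j (2 ^ i * e)%N%:R) 0.
  by have := H d (leqnn d) 0%N; rewrite mul1n add0n; apply.
elim: j => [|j IH] jd i ijd.
  rewrite addn0 in ijd; rewrite mul1r; have := h i ijd.
  rewrite horner_coef /dyadic_elim; congr mod1_near; apply: eq_bigr => k _.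
  by rewrite big_ord0 mulr1.
have h1 : mod1_near ((2 ^+ d + 1) ^+ j * eps) (dyadic_elim v j (2 ^ i.+1 * e)%N%:R) 0.
  by apply: IH; lia.
have h2 : mod1_near ((2 ^+ d + 1) ^+ j * eps) (dyadic_elim v j (2 ^ i * e)%N%:R) 0.
  by apply: IH; lia.
have := mod1_nearD h1 (mod1_nearN (mod1_nearMn (2 ^ j) h2)).
rewrite mulr0 oppr0 addr0 natrX dyadic_elimS expnS -mulnA natrM.
apply: mod1_near_le; rewrite exprS -mulrA mulrDl mul1r addrC lerD2r.
apply: ler_wpM2r; first exact: mod1_near_ge0 h1.
by apply: ler_weXn2l; [rewrite ler1n|lia].
Qed.

Lemma return_set_near v eps n : return_set v eps n -> mod1_near eps v.[n%:R] 0.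
Proof.
case=> _ /inf_lt [|y [m _ <-] /ltW h]; last by exists m; rewrite subr0.
by exists `|v.[n%:R] - 0%:~R|, 0.
Qed.

Lemma odd_poly_form_coef v i : odd_poly_form v -> v`_i != 0 -> odd i.
Proof.
case=> r [a ->]; apply: contraNT => ei; rewrite coef_sum big_nat big1 // => j hj.
rewrite coefZ coefXn; case: eqP => [e|_]; last by rewrite mulr0.
by exfalso; move: ei; rewrite e; lia.
Qed.

Lemma Delta_star_return_dyadic v l eps m : (0 < l)%N ->
  Delta_star l (return_set v eps) ->
  Delta_star l [set e | (0 < e)%N /\
    forall i, (i <= m)%N -> return_set v eps (2 ^ i * e)%N].
Proof.
move=> l0 h; elim: m => [|m IH].
  apply: Delta_starS h => [e re|e []//]; split; first by case: re.
  by move=> i; rewrite leqn0 => /eqP ->; rewrite mul1n.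
have := Delta_star_setI IH (Delta_star_scale l0 (expn_gt0 2 m.+1) h).
apply: Delta_starS => [e [[e0 h1] [_ h2]]|e []//]; split => // i.
by rewrite leq_eqVlt => /orP [/eqP ->|/h1].
Qed.

End Monomial.

Theorem theorem4p1 (R : realType) (l : nat) (hl : (1 <= l)%N) (v : {poly R})
    (hodd : odd_poly_form v) (hirr : @irrational R (lead_coef v))
    (hret : forall eps : R, 0 < eps -> Delta_star l (return_set v eps)) :
  ((size v).-1 <= 2 * l - 1)%N.
Proof.
rewrite leqNgt; apply/negP => hd; pose d := (size v).-1.
have lv0 : lead_coef v != 0 by exact: (irrational_not_int 0 hirr).
have v0 : v != 0 by rewrite -lead_coef_eq0.
have od : odd d by apply: (odd_poly_form_coef hodd).
pose p := (d - 2 * l)%N.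
have dp : d = (p + 2 * l)%N by rewrite subnK //; rewrite -/d in hd; lia.
have op : odd p by move: od; rewrite dp oddD oddM addbF.
pose c : int := \prod_(k < d) (2 ^+ d - 2 ^+ k).
have c0 : c != 0.
  by apply/prodf_neq0 => k _; rewrite subr_eq0 gt_eqF // ltr_eXn2l.
(* The elimination amplifies the error by [(2 ^ d + 1) ^ d], which leaves the [1 / 8] of the
   monomial case. *)
pose eps : R := 8^-1 / (2 ^+ d + 1) ^+ d.
have C0 : 0 < (2 ^+ d + 1) ^+ d :> R by rewrite exprn_gt0 // addr_gt0 ?exprn_gt0.
have eps0 : 0 < eps by rewrite divr_gt0 ?invr_gt0.
apply: (monomial_not_Delta_star (irrational_int_mul c0 hirr) hl op).
apply: Delta_starS (Delta_star_return_dyadic d hl (hret eps eps0)) => [e [e0 h]|e []//].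
split => //; rewrite -dp.
have := mod1_near_lead v0 (fun i id => return_set_near (h i id)).
by rewrite -/d mulrC divfK ?gt_eqF.
Qed.
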